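(* Let $J \in \mathrm{GL}_n(\mathbb{C})$ and $\mathfrak{g} = \{\Omega \in \mathbb{C}^{n\times n} : \Omega J + J\Omega^* = 0\}$. For $A, B, C \in \mathfrak{g}$ in a (sufficiently small) neighborhood of $0$, $$\mathrm{Cay}(A)\,\mathrm{Cay}(B)\,\mathrm{Cay}(C) = \mathrm{Cay}(\Omega(A,B,C)),$$ with $$\begin{aligned}\Omega(A,B,C) ={}& A + B + C + \tfrac12\big([A,B]+[A,C]+[B,C]\big) + \tfrac14[[A,B],C] - \tfrac14(ACB + BCA)\\ & - \tfrac14\big(ABA + ACA + BAB + BCB + CAC + CBC\big) + F(A,B,C),\end{aligned}$$ where $F$ is a series of homogeneous (noncommutative) polynomials in $A, B, C$ of degrees $m$ with $m \ge 4$.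
   Context: For $M \in \mathbb{C}^{n\times n}$, $M^*$ denotes the conjugate transpose. The Cayley transform of $\Omega\in\mathbb{C}^{n\times n}$ with $2 \notin \sigma(\Omega)$ (where $\sigma$ denotes the spectrum) is $\mathrm{Cay}(\Omega) = (I - \tfrac12\Omega)^{-1}(I + \tfrac12\Omega)$. The commutator is $[A,B] = AB - BA$. The set $\mathfrak{g}$ is the Lie algebra of the quadratic Lie group $G = \{M \in \mathrm{GL}_n(\mathbb{C}) : MJM^* = J\}$. *)

(* Defs.v *)
From HB Require Import structures.
From mathcomp Require Import all_boot all_order all_algebra.
From mathcomp Require Import sesquilinear spectral complex.
From mathcomp Require Import all_classical all_reals all_analysis.

Set Implicit Arguments.
Unset Strict Implicit.
Unset Printing Implicit Defensive.

Import Order.TTheory GRing.Theory Num.Theory.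
Import numFieldNormedType.Exports.

Local Open Scope classical_set_scope.
Local Open Scope ring_scope.
Local Open Scope sesquilinear_scope.

(* MathComp-Analysis puts the norm topology on abstract numClosedFieldTypes,
   but not on [complex R] itself; packaging the complex numbers as a
   numClosedFieldType makes this topology (and the entrywise one on matrices)
   inferable. *)
Definition Cplx (R : realType) : numClosedFieldType := complex R.

Section Cayley.
Context {C : numClosedFieldType} {n : nat}.
Implicit Types A B J Omega : 'M[C]_n.

Definition commutator A B : 'M[C]_n := A *m B - B *m A.

(* [eigenvalue] is about row eigenvectors; the spectrum is the same. *)
Definition spectrum Omega : set C := [set a | eigenvalue Omega a].

(* Meaningful only when 2 is not in the spectrum of Omega: [invmx] is the
   identity on singular matrices. *)
Definition Cay Omega : 'M[C]_n :=
  invmx (1%:M - 2^-1 *: Omega) *m (1%:M + 2^-1 *: Omega).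

Definition quad_lie_alg J : set 'M[C]_n :=
  [set Omega | Omega *m J + J *m Omega ^t* = 0].

End Cayley.

(* A homogeneous polynomial of degree m in k noncommuting variables over C is
   a linear combination of the k ^ m words of length m, hence is given by its
   coefficients. *)
Definition nchom (C : Type) (k m : nat) : Type := {ffun m.-tuple 'I_k -> C}.

Definition nceval (C : numClosedFieldType) (k m n : nat) (p : nchom C k m)
    (X : 'I_k -> 'M[C]_n) : 'M[C]_n :=
  \sum_(w : m.-tuple 'I_k) p w *: \big[mulmx/1%:M]_(i <- w) X i.

Definition vars3 (T : Type) (A B C : T) (i : 'I_3) : T :=
  tnth [tuple A; B; C] i.

(* Main.v *)
Require Import Defs.
From HB Require Import structures.
From mathcomp Require Import all_boot all_order all_algebra.
From mathcomp Require Import complex ring.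
From mathcomp Require Import all_classical all_reals all_analysis.
Import Order.TTheory GRing.Theory Num.Theory numFieldNormedType.Exports.
Local Open Scope classical_set_scope.
Local Open Scope ring_scope.

Set Implicit Arguments.
Unset Strict Implicit.
Unset Printing Implicit Defensive.

(** The product of Cayley transforms of k small matrices X_0, ..., X_(k-1) is
    the Cayley transform of a matrix W that has an explicit noncommutative
    power series: the coefficient of a word i_1 ... i_m (m >= 1) is
      2^(1-m) sgn(i_2 - i_1) sgn(i_3 - i_2) ... sgn(i_m - i_(m-1)).
    Reading off the words of length at most 3 for k = 3 gives the displayed
    polynomial, and the longer words give F.

    To see where this comes from, let a_i collect the terms of W / 2 whose
    word starts with i. The form of the coefficients says that
      a_i = (X_i / 2) (1 + sum_(j > i) a_j - sum_(j < i) a_j).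
    Put S_m = 1 + sum_(j >= m) a_j - sum_(j < m) a_j. Then
    S_i - S_(i+1) = 2 a_i, while S_i + S_(i+1) is twice the parenthesis above,
    so the equation for a_i reads S_i - S_(i+1) = (X_i / 2) (S_i + S_(i+1)),
    that is, S_i = Cay(X_i) S_(i+1). The product P of the Cay(X_i) therefore
    satisfies P S_k = S_0, where S_0 = 1 + W / 2 and S_k = 1 - W / 2. Adding
    1 - W / 2 on both sides gives (P + 1) (1 - W / 2) = 2, so 1 - W / 2 is
    invertible without any estimate on W, and P = Cay(W) (Cay_unique,
    Cay_prod).

    Existence and convergence: the equations are a = b + T a, with T linear on
    families of matrices and contracting by 1/2 for a sum norm when the X_i are
    small (sumnorm_prepend_letter). Thus 1 - T is injective, hence bijective in
    finite dimension, and the solution a is obtained by linear algebra, without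
    appeal to completeness. The partial sums of the series are those of the
    sum of the T^l b; those with m terms miss a by exactly T^m a, which tends
    to 0 (iter_tail, Cay_series_cvg). *)

(** * The sup norm of matrices *)

Lemma normmx_le (K : numFieldType) m n (A : 'M[K]_(m, n)) (c : K) :
  0 <= c -> (forall i j, `|A i j| <= c) -> `|A| <= c.
Proof.
move=> c0 Ac; rewrite [`|A|]/Num.norm /= mx_normE.
rewrite -[c]/((NngNum c0)%:num) num_le.
by apply/bigmax_leP; split => [|[i j] _] /=; rewrite -num_le /=.
Qed.

Lemma normmx_ge (K : numFieldType) m n (A : 'M[K]_(m, n)) i j :
  `|A i j| <= `|A|.
Proof.
rewrite [leRHS]/Num.norm /= mx_normE.
have <- : (`|A i j|%:nng)%:num = `|A i j| by [].
by rewrite num_le; apply/bigmax_geP; right; exists (i, j).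
Qed.

Lemma normmxM (K : numFieldType) m n p (A : 'M[K]_(m, n)) (B : 'M[K]_(n, p)) :
  `|A *m B| <= n%:R * `|A| * `|B|.
Proof.
apply: normmx_le => [|i j]; first by rewrite !mulr_ge0.
rewrite mxE (le_trans (ler_norm_sum _ _ _)) //.
rewrite -mulrA mulr_natl -[X in _ *+ X]card_ord -sumr_const.
by apply: ler_sum => l _; rewrite normrM ler_pM // normmx_ge.
Qed.

(** * Products of Cayley transforms *)

Lemma mulmx_telescope (K : pzRingType) (n k : nat) (P : 'I_k -> 'M[K]_n)
    (S : nat -> 'M[K]_n) :
    (forall i : 'I_k, P i *m S i.+1 = S i) ->
  (\big[mulmx/1%:M]_(i < k) P i) *m S k = S 0%N.
Proof.
elim: k P S => [|k IHk] P S PS; first by rewrite big_ord0 mul1mx.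
rewrite big_ord_recl -mulmxA (IHk _ (S \o succn)) /=; first exact: PS.
by move=> i; exact: PS (lift ord0 i).
Qed.

Definition order_sign (K : pzRingType) k (i j : 'I_k) : K :=
  (i < j)%N%:R - (j < i)%N%:R.

Section CayleyProduct.
Variables (K : numClosedFieldType) (n : nat).
Implicit Types A X : 'M[K]_n.

Lemma unitmx_eigenvalue2 A :
  (1%:M - 2^-1 *: A \in unitmx) = ~~ eigenvalue A 2.
Proof.
rewrite -row_free_unit -kermx_eq0 /eigenvalue /eigenspace negbK.
have -> : A - 2%:M = (- 2%:R) *: (1%:M - 2^-1 *: A).
  by rewrite scalerBr scalerA mulNr divff ?pnatr_eq0 // scaleN1r opprK
    scaleNr scalemx1 addrC.
by rewrite !kermx_eq0 /row_free mxrank_scale_nz // oppr_eq0 pnatr_eq0.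
Qed.

Lemma eigenvalue2_small A : n%:R * `|A| <= 1 -> ~~ eigenvalue A 2.
Proof.
move=> A1; apply/eigenvalueP => -[v vA]; apply/negP; rewrite negbK.
have : 2 * `|v| <= 1 * `|v|.
  have -> : 2 * `|v| = `|v *m A| by rewrite vA normrZ ger0_norm.
  by rewrite (le_trans (normmxM _ _)) // mulrAC ler_wpM2r.
rewrite mul1r mulr_natl mulr2n gerDl => v0.
by rewrite -normr_le0.
Qed.

(** [Cay W] is pinned down by its defining equation alone: adding [1 - W / 2] to
    both sides yields [(P + 1) (1 - W / 2) = 2], which already provides the
    inverse of [1 - W / 2]. *)
Lemma Cay_unique (P W : 'M[K]_n) :
    P *m (1%:M - 2^-1 *: W) = 1%:M + 2^-1 *: W ->
  ~~ eigenvalue W 2 /\ P = Cay W.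
Proof.
move=> PW; set D := 1%:M - 2^-1 *: W.
have PD : P *m D = 2%:M - D.
  rewrite PW; apply/matrixP => i j; rewrite !mxE.
  by case: eqP => _ /=; ring.
have D1 : (2^-1 *: (P + 1%:M)) *m D = 1%:M.
  rewrite -scalemxAl mulmxDl PD mul1mx subrK scale_scalar_mx.
  by rewrite mulVf ?pnatr_eq0.
have [_ Du] := mulmx1_unit D1.
split; first by rewrite -unitmx_eigenvalue2.
rewrite /Cay -/D -PW -/D PD mulmxBr (mulVmx Du).
have -> : invmx D = 2^-1 *: (P + 1%:M).
  by rewrite -[RHS](mulmxK Du) D1 mul1mx.
apply/matrixP => i j; rewrite mul_mx_scalar !mxE.
by field.
Qed.

(** The linear system satisfied by the parts of [W / 2] with a given first
    letter is what makes the product telescope. *)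
Lemma Cay_prod k (X a : 'I_k -> 'M[K]_n) :
    (forall i, ~~ eigenvalue (X i) 2) ->
    (forall i, a i = 2^-1 *: X i *m (1%:M + \sum_j order_sign K i j *: a j)) ->
  let W := 2 *: \sum_i a i in
  ~~ eigenvalue W 2 /\ \big[mulmx/1%:M]_(i < k) Cay (X i) = Cay W.
Proof.
move=> X2 aE W; apply: Cay_unique.
(* S i = Cay (X i) *m S i.+1 interpolates between 1 + W / 2 and 1 - W / 2. *)
pose S m : 'M[K]_n := 1%:M + \sum_(j < k) ((m <= j)%N%:R - (j < m)%N%:R) *: a j.
have W2 : 2^-1 *: W = \sum_i a i.
  by rewrite /W scalerA mulVf ?pnatr_eq0 // scale1r.
have S0 : S 0%N = 1%:M + 2^-1 *: W.
  rewrite W2; congr (_ + _); apply: eq_bigr => j _.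
  by rewrite leq0n ltn0 subr0 scale1r.
have Sk : S k = 1%:M - 2^-1 *: W.
  rewrite W2 -sumrN; congr (_ + _); apply: eq_bigr => j _.
  by rewrite leqNgt ltn_ord sub0r scaleN1r.
rewrite -S0 -Sk; apply: mulmx_telescope => i.
have SB : S i - S i.+1 = 2 *: a i.
  rewrite /S opprD addrACA subrr add0r -sumrB (bigD1 i) //= big1 => [|j ji].
    by rewrite leqnn !ltnn ltnS leqnn !(subr0, sub0r) scaleN1r scale1r opprK
      addr0 scaler_nat mulr2n.
  rewrite ltnS; move: ji; rewrite -val_eqE /=.
  by case: ltngtP => //= _ _; rewrite ?subrr.
have SD : S i + S i.+1 = 2 *: (1%:M + \sum_j order_sign K i j *: a j).
  rewrite /S addrACA -big_split /= scalerDr scaler_nat -mulr2n; congr (_ + _).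
  rewrite scaler_sumr; apply: eq_bigr => j _; rewrite -scalerDl scalerA.
  congr (_ *: _); rewrite /order_sign ltnS.
  by case: ltngtP => _ /=; ring.
have u : 1%:M - 2^-1 *: X i \in unitmx by rewrite unitmx_eigenvalue2.
rewrite /Cay -mulmxA; apply: (canLR (mulKmx u)).
rewrite mulmxDl mulmxBl !mul1mx.
apply/eqP; rewrite eq_sym subr_eq -addrA addrC -subr_eq -mulmxDr SB addrC SD.
by rewrite -scalemxAr -aE.
Qed.

End CayleyProduct.

(** * The series over words *)

Lemma big_tupleS (V : nmodType) (I : finType) m (f : m.+1.-tuple I -> V) :
  \sum_w f w = \sum_i \sum_(w : m.-tuple I) f [tuple of i :: w].
Proof.
rewrite pair_big /=.
rewrite (reindex (fun iw : I * m.-tuple I => [tuple of iw.1 :: iw.2])) //=.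
exists (fun w => (thead w, [tuple of behead w])) => [[i w] _|w _] /=.
  by congr pair; apply: val_inj.
by rewrite [RHS]tuple_eta.
Qed.

Section Words.
Variables (K : numClosedFieldType) (n k : nat) (X : 'I_k -> 'M[K]_n).

Fixpoint step_sign (w : seq 'I_k) : K :=
  if w is i :: w' then
    (if w' is j :: _ then order_sign K i j else 1) * step_sign w'
  else 1.

(** The value 2 at the empty word is only a default: all sums below start at
    words of length 1, and [W] has no constant term. *)
Definition Cay_coef m : nchom K k m :=
  [ffun w : m.-tuple 'I_k => 2 * 2^-1 ^+ m * step_sign w].

(** If [a j] is a sum over words starting with [j], then [prepend_letter a i] is
    the sum over the words obtained by putting one more letter [i] in front. *)
Definition prepend_letter (a : {ffun 'I_k -> 'M[K]_n}) :
    {ffun 'I_k -> 'M[K]_n} :=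
  [ffun i => 2^-1 *: X i *m \sum_j order_sign K i j *: a j].

Fact prepend_letter_is_linear : linear prepend_letter.
Proof.
move=> c a b; apply/ffunP => i; rewrite !ffunE scalemxAr -mulmxDr scaler_sumr.
rewrite -big_split /=; congr (_ *m _); apply: eq_bigr => j _.
by rewrite !ffunE scalerDr !scalerA mulrC.
Qed.
HB.instance Definition _ :=
  GRing.isLinear.Build K {ffun 'I_k -> 'M[K]_n} {ffun 'I_k -> 'M[K]_n} *:%R
    prepend_letter prepend_letter_is_linear.

Definition half_letters : {ffun 'I_k -> 'M[K]_n} := [ffun i => 2^-1 *: X i].

Lemma iter_prepend_letterE m i :
  iter m prepend_letter half_letters i =
  2^-1 ^+ m.+1 *: \sum_(w : m.-tuple 'I_k)
    step_sign (i :: w) *: \big[mulmx/1%:M]_(j <- i :: w) X j.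
Proof.
elim: m i => [|m IHm] i.
  rewrite (big_pred1 [tuple]) /= => [|w]; last first.
    by rewrite [w]tuple0; apply/esym/eqP.
  by rewrite ffunE expr1 big_cons big_nil mulmx1 mulr1 scale1r.
rewrite iterS ffunE big_tupleS exprS -scalerA -scalemxAl; congr (_ *: _).
rewrite mulmx_sumr scaler_sumr; apply: eq_bigr => j _.
rewrite IHm scalerA mulrC -scalerA -scalemxAr; congr (_ *: _).
rewrite scaler_sumr mulmx_sumr; apply: eq_bigr => w _.
by rewrite scalerA -scalemxAr [in RHS]big_cons.
Qed.

Lemma nceval_Cay_coef m :
  nceval (Cay_coef m.+1) X = 2 *: \sum_i iter m prepend_letter half_letters i.
Proof.
rewrite /nceval.
under eq_bigr do rewrite ffunE -scalerA.
rewrite -scaler_sumr big_tupleS -scalerA; congr (_ *: _).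
by rewrite scaler_sumr; apply: eq_bigr => i _; rewrite iter_prepend_letterE.
Qed.

Definition sumnorm (a : {ffun 'I_k -> 'M[K]_n}) : K := \sum_i `|a i|.

Hypothesis X_small : n%:R * \sum_i `|X i| <= 1.

(** One factor 1/2 comes from the halved letter; the size of the [X i] and the
    dimension constant of [normmxM] are absorbed by [X_small]. *)
Lemma sumnorm_prepend_letter a : sumnorm (prepend_letter a) <= 2^-1 * sumnorm a.
Proof.
have sum_le i : `|\sum_j order_sign K i j *: a j| <= sumnorm a.
  rewrite (le_trans (ler_norm_sum _ _ _)) // ler_sum // => j _.
  rewrite normrZ ler_piMl // /order_sign.
  by case: ltngtP => _; rewrite ?subrr ?subr0 ?sub0r ?normr0 ?normrN ?normr1.
have a0 : 0 <= sumnorm a by rewrite sumr_ge0.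
rewrite [leRHS](_ : _ = 2^-1 * (1 * sumnorm a)); last by rewrite mul1r.
apply: le_trans (ler_wpM2l _ (ler_wpM2r a0 X_small)); last by rewrite invr_ge0.
move: (sumnorm a) sum_le a0 => s sum_le s0.
rewrite mulr_sumr mulr_suml mulr_sumr; apply: ler_sum => i _.
rewrite ffunE (le_trans (normmxM _ _)) //.
rewrite normrZ ger0_norm ?invr_ge0 // mulrCA -mulrA ler_wpM2l ?invr_ge0 //.
by rewrite ler_wpM2l // !mulr_ge0.
Qed.

Lemma sumnorm_iter m a :
  sumnorm (iter m prepend_letter a) <= 2^-1 ^+ m * sumnorm a.
Proof.
elim: m => [|m IHm]; first by rewrite expr0 mul1r.
rewrite iterS (le_trans (sumnorm_prepend_letter _)) // exprS -mulrA.
by rewrite ler_wpM2l // invr_ge0.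
Qed.

(** The identity minus a contraction is injective, so in finite dimension it is
    onto: this replaces summing the Neumann series. *)
Lemma prepend_letter_fixpoint (b : {ffun 'I_k -> 'M[K]_n}) :
  exists a, a = b + prepend_letter a.
Proof.
pose f : 'End({ffun 'I_k -> 'M[K]_n}) := (\1 - linfun prepend_letter)%VF.
have fE a : f a = a - prepend_letter a.
  by rewrite !lfun_simp /=.
have f0 : lker f == 0%VS.
  apply/eqP/vspaceP => a; rewrite memv_ker memv0 fE subr_eq0.
  apply/eqP/eqP => [aE|->]; last by rewrite linear0.
  have := sumnorm_prepend_letter a; rewrite -aE.
  rewrite mulrC ler_pdivlMr // mulr_natr mulr2n gerDl => a0.
  apply/ffunP => i; rewrite !ffunE; apply/eqP; rewrite -normr_le0.
  rewrite (le_trans _ a0) // /sumnorm (bigD1 i) //= lerDl.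
  by rewrite sumr_ge0.
exists (f^-1%VF b).
by rewrite -{2}(lker0_lfunVK f0 b) fE subrK.
Qed.

Lemma iter_tail b a m : a = b + prepend_letter a ->
  \sum_(l < m) iter l prepend_letter b + iter m prepend_letter a = a.
Proof.
move=> aE; elim: m => [|m IHm]; first by rewrite big_ord0 add0r.
have iterD : iter m prepend_letter a =
    iter m prepend_letter b + iter m.+1 prepend_letter a.
  rewrite iterSr {1}aE; elim: m {IHm} => //= m ->; exact: linearD.
by rewrite big_ord_recr /= -addrA -iterD.
Qed.

End Words.

(** * Convergence and the closed form *)

(** The order of the complex numbers is only partial, but [`|M| / e] is real, so
    the archimedean property of [R] applies to it. *)
Lemma cvg_half_geometric (R : realType) (M : Cplx R) :
  (2^-1 ^+ m * M) @[m --> \oo] --> (0 : Cplx R).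
Proof.
apply/cvgr0Pnorm_lt => e e0.
have Me : `|M| / e \is Num.real by rewrite ger0_real // divr_ge0 // ltW.
have /complex_realP[x xE] : (`|M| / e : complex R) \is Num.real := Me.
near=> m.
have M1 : `|M| < m%:R * e.
  rewrite -ltr_pdivrMr // [X in X < _](xE : _ = (x%:C)%C).
  have -> : (m%:R : Cplx R) = ((m%:R)%:C)%C :> complex R.
    by rewrite rmorph_nat.
  by rewrite [_ < _]ltcR; near: m; exact: nbhs_infty_gtr.
rewrite normrM normrX ger0_norm ?invr_ge0 // exprVn mulrC.
rewrite ltr_pdivrMr ?exprn_gt0 //.
rewrite (lt_trans M1) // mulrC ltr_pM2l // -natrX ltr_nat.
exact: ltn_expl.
Unshelve. all: by end_near.
Qed.

Section Convergence.
Variables (R : realType) (n k : nat) (X : 'I_k -> 'M[Cplx R]_n).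
Hypothesis X_small : n%:R * \sum_i `|X i| <= 1.

Lemma Cay_series_cvg a : a = half_letters X + prepend_letter X a ->
  \sum_(1 <= m < N) nceval (Cay_coef _ k m) X @[N --> \oo] --> 2 *: \sum_i a i.
Proof.
move=> aE; rewrite -cvg_shiftS; apply/cvgrPdist_lt => e e0.
have /cvgr0Pnorm_lt/(_ e e0) := cvg_half_geometric (2 * sumnorm a).
apply: filterS => N; apply: le_lt_trans.
have partial : \sum_(1 <= m < N.+1) nceval (Cay_coef (Cplx R) k m) X =
    2 *: \sum_i (\sum_(m < N) iter m (prepend_letter X) (half_letters X)) i.
  rewrite big_add1 /= big_mkord.
  under [LHS]eq_bigr do rewrite nceval_Cay_coef.
  rewrite -scaler_sumr exchange_big; congr (_ *: _).
  by apply: eq_bigr => i _; rewrite sum_ffunE.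
rewrite /= partial -scalerBr -sumrB normrZ.
rewrite (eq_bigr (iter N (prepend_letter X) a)) => [|i _]; last first.
  by rewrite -{1}(iter_tail N aE) ffunE addrAC subrr add0r.
rewrite (ger0_norm (ler0n _ 2)) [leRHS]ger0_norm; last first.
  by rewrite !mulr_ge0 ?exprn_ge0 ?invr_ge0 // sumr_ge0.
rewrite mulrCA ler_wpM2l // (le_trans _ (sumnorm_iter X_small N a)) //.
exact: ler_norm_sum.
Qed.

Theorem Cay_prod_series :
  exists W : 'M[Cplx R]_n,
    [/\ \sum_(1 <= m < N) nceval (Cay_coef (Cplx R) k m) X @[N --> \oo] --> W,
    ~~ eigenvalue W 2 & \big[mulmx/1%:M]_(i < k) Cay (X i) = Cay W].
Proof.
have [a aE] := prepend_letter_fixpoint X_small (half_letters X).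
exists (2 *: \sum_i a i).
have X2 i : ~~ eigenvalue (X i) 2.
  apply: eigenvalue2_small; apply: le_trans X_small; rewrite ler_wpM2l //.
  by rewrite (bigD1 i) //= lerDl sumr_ge0.
have [|W2 ->] := @Cay_prod (Cplx R) n k X a X2.
  by move=> i; rewrite {1}aE !ffunE mulmxDr mulmx1.
by split=> //; exact: Cay_series_cvg.
Qed.
End Convergence.

(** * Three factors *)

Lemma Cay_series_deg3 (K : numClosedFieldType) n (A B C : 'M[K]_n) :
  \sum_(1 <= m < 4) nceval (Cay_coef K 3 m) (vars3 A B C) =
    A + B + C
    + 2^-1 *: (commutator A B + commutator A C + commutator B C)
    + 4^-1 *: commutator (commutator A B) C
    - 4^-1 *: (A *m C *m B + B *m C *m A)
    - 4^-1 *: (A *m B *m A + A *m C *m A + B *m A *m B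
               + B *m C *m B + C *m A *m C + C *m B *m C).
Proof.
rewrite 3?big_nat_recl // big_geq // !nceval_Cay_coef /= /commutator.
rewrite !big_ord_recl !big_ord0 /= !ffunE.
rewrite !big_ord_recl !big_ord0 /= !ffunE.
rewrite !big_ord_recl !big_ord0 /= !ffunE.
rewrite /order_sign /vars3 !(tnth_nth 0) /=.
rewrite !(mulmxDl, mulmxDr, mulmxBl, mulmxBr, mulNmx, mulmxN,
  =^~ scalemxAl, =^~ scalemxAr, mulmxA, mulmx0).
(* Once the words are opaque, both sides are linear in them, and the
   identity can be checked entrywise over the commutative field. *)
repeat match goal with |- context [?P *m ?Q *m ?S] =>
  move: (P *m Q *m S) => ? end.
repeat match goal with |- context [?P *m ?Q] => move: (P *m Q) => ? end.
by apply/matrixP => i j; rewrite !mxE; field.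
Qed.

Lemma lim_mx (R : realType) n (u : nat -> 'M[Cplx R]_n) l :
  u @ \oo --> l -> lim (u @ \oo) = l.
Proof. exact: (cvg_lim (@norm_hausdorff (Cplx R) 'M[Cplx R]_n)). Qed.

Theorem proposition3p1 (R : realType) (n : nat) (J : 'M[Cplx R]_n)
    (hJ : J \in unitmx) :
  exists (p : forall m : nat, nchom (Cplx R) 3 m)
         (F : 'M[Cplx R]_n -> 'M[Cplx R]_n -> 'M[Cplx R]_n -> 'M[Cplx R]_n)
         (U : set 'M[Cplx R]_n),
    nbhs (0 : 'M[Cplx R]_n) U /\
    forall A B C : 'M[Cplx R]_n,
      quad_lie_alg J A -> quad_lie_alg J B -> quad_lie_alg J C ->
      U A -> U B -> U C ->
      let Omega :=
        A + B + C
        + 2^-1 *: (commutator A B + commutator A C + commutator B C)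
        + 4^-1 *: commutator (commutator A B) C
        - 4^-1 *: (A *m C *m B + B *m C *m A)
        - 4^-1 *: (A *m B *m A + A *m C *m A + B *m A *m B
                   + B *m C *m B + C *m A *m C + C *m B *m C)
        + F A B C in
      [/\ \sum_(4 <= m < N) nceval (p m) (vars3 A B C) @[N --> \oo]
            --> F A B C,
          [/\ ~ spectrum A 2, ~ spectrum B 2, ~ spectrum C 2
            & ~ spectrum Omega 2]
        & Cay A *m Cay B *m Cay C = Cay Omega].
Proof.
pose term A B C m := nceval (Cay_coef (Cplx R) 3 m) (@vars3 'M[Cplx R]_n A B C).
pose high A B C N : 'M[Cplx R]_n := \sum_(4 <= m < N) term A B C m.
pose F A B C := lim (high A B C @ \oo).
exists (Cay_coef (Cplx R) 3), F.
(* The radius makes n * (|A| + |B| + |C|) at most 1. *)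
exists [set A | `|A| < (3 * n.+1)%:R^-1]; split.
  by apply: (@nbhs0_lt (Cplx R) 'M[Cplx R]_n); rewrite invr_gt0 ltr0n.
move=> A B C _ _ _ Asmall Bsmall Csmall Omega.
have small : n%:R * \sum_i `|vars3 A B C i| <= 1.
  rewrite !big_ord_recl big_ord0 /= /vars3 !(tnth_nth 0) /=.
  apply: (@le_trans _ _ (n%:R * ((3 * n.+1)%:R^-1 *+ 3))).
    rewrite ler_wpM2l //.
    move: (_^-1) (Asmall) (Bsmall) (Csmall) => /= r /ltW ? /ltW ? /ltW ?.
    by rewrite addr0 mulrS mulr2n !lerD.
  rewrite -[_^-1 *+ 3]mulr_natr mulrA mulrAC -natrM ler_pdivrMr ?ltr0n //.
  by rewrite mul1r ler_nat mulnC leq_mul2l leqnSn.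
have [W [Wcvg W2 PW]] := Cay_prod_series small.
have X2 i : ~~ eigenvalue (vars3 A B C i) 2.
  apply: eigenvalue2_small; apply: le_trans small; rewrite ler_wpM2l //.
  by rewrite (bigD1 i) //= lerDl sumr_ge0.
have tail : high A B C @ \oo --> W - \sum_(1 <= m < 4) term A B C m.
  apply: cvg_trans (cvgB Wcvg (cvg_cst _)).
  apply: near_eq_cvg; near=> N; rewrite !fctE /high /=.
  rewrite (big_cat_nat _ _ (n := 4)) //=; last by near: N; exists 4%N.
  by rewrite addrC addKr.
have FE : F A B C = W - \sum_(1 <= m < 4) term A B C m.
  exact: lim_mx tail.
have OmegaE : Omega = W by rewrite /Omega FE -Cay_series_deg3 addrC subrK.
clearbody Omega; rewrite {}OmegaE; split.
- by rewrite FE.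
- have := X2 (@Ordinal 3 0 isT); have := X2 (@Ordinal 3 1 isT).
  have := X2 (@Ordinal 3 2 isT); rewrite /vars3 !(tnth_nth 0) /= => XC XB XA.
  split; apply/negP; [exact: XA|exact: XB|exact: XC|exact: W2].
- rewrite -PW !big_ord_recl big_ord0 /= /vars3 !(tnth_nth 0) /=.
  by move: (Cay A) (Cay B) (Cay C) => P Q S; rewrite mulmx1 mulmxA.
Unshelve. all: by end_near.
Qed.
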